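(* For every $n\ge 1$, the Hrushovski limit $M_n$ is a model of $T_n$, i.e. $M_n$ is a free pseudospace of dimension $n$.
   Context: Graphs. For $m\ge 1$, $L_m$ is the language with unary predicates $V_0,\dots,V_m$ and a binary relation $E$. An $L_m$-graph is an (undirected) graph with edge relation $E$ whose vertex set is partitioned into $V_0,\dots,V_m$ (vertices in $V_i$ are ''of type $V_i$''), such that every edge joins a vertex of type $V_{i-1}$ to a vertex of type $V_i$ for some $1\le i\le m$. A path is a sequence of vertices in which consecutive vertices are joined by an edge; its length is its number of edges. An $E_i$-path is a path with all vertices in $V_{i-1}\cup V_i$; an $E_i\cup\dots\cup E_{i+j}$-path is a path with all vertices in $V_{i-1}\cup\dots\cup V_{i+j}$. A simple cycle $(a,b,\dots,b',a)$ is a closed path with no repeated vertices except the coinciding endpoints (and $b\neq b'$). An $E_i$-cycle is a simple cycle in $V_{i-1}\cup V_i$. Incidence. For $i\le j$, a vertex $x_i$ of type $V_i$ and a vertex $x_j$ of type $V_j$ are incident if there is a sequence $(x_i,x_{i+1},\dots,x_j)$ with $x_l$ of type $V_l$ and $E(x_{l-1},x_l)$ for $l=i+1,\dots,j$ (so a vertex is incident with itself); such a sequence is called a dense flag. The residue $R(x)$ is the set of vertices incident with $x$. Vertices $x,y$ intersect in the vertex $z$ if the set of type-$V_0$ vertices incident with both $x$ and $y$ equals the set of type-$V_0$ vertices incident with $z$; they intersect in the empty set if no type-$V_0$ vertex is incident with both. Dually, $x,y$ generate the vertex $z$ if the set of vertices of the top type ($V_m$ in an $L_m$-graph) incident with both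 $x$ and $y$ equals the set of top-type vertices incident with $z$; they generate the empty set if no top-type vertex is incident with both. Free pseudospaces (inductive definition). A free pseudospace of dimension $1$ is an $L_1$-graph containing no simple cycles in which every vertex has infinitely many neighbours. For $m\ge 2$, a free pseudospace of dimension $m$ is an $L_m$-graph such that: $(\Sigma1)_m$ (a) the induced graph on $V_0\cup\dots\cup V_{m-1}$ is a free pseudospace of dimension $m-1$; (b) the induced graph on $V_1\cup\dots\cup V_m$ (with types renumbered) is a free pseudospace of dimension $m-1$. $(\Sigma2)_m$ (a) for each $x$ of type $V_0$, the induced graph on $R(x)\cap(V_1\cup\dots\cup V_m)$ (types renumbered) is a free pseudospace of dimension $m-1$; (b) for each $x$ of type $V_m$, the induced graph on $R(x)\cap(V_0\cup\dots\cup V_{m-1})$ is a free pseudospace of dimension $m-1$. $(\Sigma3)_m$ (a) any two vertices intersect in some vertex or the empty set; (b) any two vertices generate some vertex or the empty set. $(\Sigma4)_m$ (a) if $a$ is of type $V_m$ and $\gamma=(a,b,\dots,b',a)$ is a simple cycle of length $k$, then there is an $E_1\cup\dots\cup E_{m-1}$-path from $b$ to $b'$ of length at most $k-1$ in $R(a)$ all of whose $V_0$-vertices appear in $\gamma$; (b) if $a$ is of type $V_0$ and $\gamma=(a,b,\dots,b',a)$ is a simple cycle of length $k$, then there is an $E_2\cup\dots\cup E_m$-path from $b$ to $b'$ of length at most $k-1$ in $R(a)$ all of whose $V_m$-vertices appear in $\gamma$. $T_n$ denotes the $L_n$-theory expressing the axioms of a free pseudospace of dimension $n$. The class $\mathcal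 K_n$ consists of the finite $L_n$-graphs $A$ such that: (1) $A$ contains no $E_i$-cycles, $i=1,\dots,n$; (2) any $a\ne a'$ in $A$ intersect (in $A$) in a vertex of $A$ or the empty set; (3) any $a\neq a'$ in $A$ generate (in $A$) a vertex of $A$ or the empty set; (4) if $a\in V_i$, $b,b'\in V_{i-1}$ and $\gamma=(a,b,\dots,b',a)$ is a simple cycle of length $k$ contained in $V_h\cup\dots\cup V_i$, $h\le i-2$, then there is a path from $b$ to $b'$ of length at most $k-1$ in $R(a)\cap(V_h\cup\dots\cup V_{i-1})$ all of whose $V_h$-vertices occur in $\gamma$; (5) if $a\in V_i$, $b,b'\in V_{i+1}$ and $\gamma=(a,b,\dots,b',a)$ is a simple cycle of length $k$ contained in $V_i\cup\dots\cup V_h$, $h\ge i+2$, then there is a path from $b$ to $b'$ of length at most $k-1$ in $R(a)\cap(V_{i+1}\cup\dots\cup V_h)$ all of whose $V_h$-vertices occur in $\gamma$. Strong extensions. For a finite $L_n$-graph $A$, the elementary strong extensions of $A$ are obtained by: (1) adding a vertex of any type connected to at most one vertex of $A$ (of an appropriate type); or (2) if $(x,y,z)$ is a dense flag in $A$, adding a vertex of the same type as $y$ connected to exactly $x$ and $z$. Write $A\le B$ if $B$ arises from $A$ by finitely many elementary strong extensions. $M_n$ is the (countable) Hrushovski limit of $(\mathcal K_n,\le)$: $M_n=\bigcup_i A_i$ for a chain $\emptyset=A_0\le A_1\le\cdots$ of members of $\mathcal K_n$ such that whenever $A\le A_i$ and $A\le C\in\mathcal K_n$, there are $j\ge i$ and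 an embedding $g:C\to A_j$ that is the identity on $A$ with $g(C)\le A_j$. It is unique up to isomorphism. *)

(* Defs.v *)
From mathcomp Require Import all_boot.
From mathcomp Require Import boolp classical_sets functions cardinality.

Set Implicit Arguments.
Unset Strict Implicit.
Unset Printing Implicit Defensive.

Local Open Scope classical_set_scope.

(* A typed graph is carried by a set of vertices inside an ambient type, so
   that induced subgraphs and unions of chains live on the same type. The
   values of [typ] and [adj] outside [vert] are irrelevant: every notion below
   only looks at elements of [vert]. *)
Record tgraph (T : Type) := TGraph {
  vert : set T;
  typ : T -> nat;
  adj : rel T
}.

Definition induced T (G : tgraph T) (D : set T) : tgraph T :=
  TGraph (vert G `&` D) (typ G) (adj G).

(* Type i becomes type i - 1; only used on graphs without vertices of type 0. *)
Definition renumber T (G : tgraph T) : tgraph T :=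
  TGraph (vert G) (fun x => (typ G x).-1) (adj G).

(* V_i \cup ... \cup V_j *)
Definition layers T (G : tgraph T) (i j : nat) : set T :=
  [set x | vert G x /\ i <= typ G x <= j].

Definition Lgraph T (m : nat) (G : tgraph T) : Prop :=
  [/\ forall x, vert G x -> typ G x <= m,
      forall x y, vert G x -> vert G y -> adj G x y -> adj G y x
    & forall x y, vert G x -> vert G y -> adj G x y ->
        typ G y = (typ G x).+1 \/ typ G x = (typ G y).+1].

Section Graphs.
Variables (T : choiceType) (G : tgraph T).

(* The path is x :: p, of length [size p]. *)
Definition gpath (D : set T) (x : T) (p : seq T) (y : T) : Prop :=
  [/\ path (adj G) x p, last x p = y & [set` x :: p] `<=` vert G `&` D].

(* [s] lists the vertices of the closed path without repeating the starting
   point, so its length (number of edges) is [size s]; b != b' in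
   (a, b, ..., b', a) amounts to [2 < size s]. *)
Definition simple_cycle (D : set T) (s : seq T) : Prop :=
  [/\ cycle (adj G) s, uniq s, 2 < size s & [set` s] `<=` vert G `&` D].

Definition dense_flag (x : T) (p : seq T) : Prop :=
  path (fun u v => adj G u v && (typ G v == (typ G u).+1)) x p
  /\ [set` x :: p] `<=` vert G.

Definition incident (x y : T) : Prop :=
  (exists2 p, dense_flag x p & last x p = y) \/
  (exists2 p, dense_flag y p & last y p = x).

Definition residue (x : T) : set T := [set y | incident x y].

(* The vertices of type t incident with x. *)
Definition shadow (t : nat) (x : T) : set T := residue x `&` layers G t t.

(* t = 0: x and y intersect in a vertex or the empty set;
   t the top type: x and y generate a vertex or the empty set. *)
Definition meets (t : nat) (x y : T) : Prop :=
  (exists2 z, vert G z & shadow t x `&` shadow t y = shadow t z) \/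
  shadow t x `&` shadow t y = set0.

(* For the cycle s = (a, b, ..., b', a): there is a path of length at most
   size s - 1 from b to b' in R(a) and in layers i to j, all of whose vertices
   of type t occur in s. *)
Definition detour (t i j : nat) (a b b' : T) (s : seq T) : Prop :=
  exists q, [/\ gpath (residue a `&` layers G i j) b q b',
                size q <= (size s).-1
              & forall v, v \in b :: q -> typ G v = t -> v \in s].

End Graphs.

(* The dimension is at least 1; the value at 0 is a placeholder. *)
Fixpoint free_pseudospace (T : choiceType) (m : nat) (G : tgraph T) : Prop :=
  match m with
  | 0 => False
  | m'.+1 =>
    match m' with
    | 0 =>
      [/\ Lgraph 1 G,
          forall s, ~ simple_cycle G setT s
        & forall x, vert G x -> infinite_set [set y | vert G y /\ adj G x y]]
    | _.+1 =>
      [/\ Lgraph m G,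
          (* Sigma 1 *)
          free_pseudospace m' (induced G (layers G 0 m')) /\
          free_pseudospace m' (renumber (induced G (layers G 1 m))),
          (* Sigma 2 *)
          (forall x, vert G x -> typ G x = 0 ->
             free_pseudospace m'
               (renumber (induced G (residue G x `&` layers G 1 m)))) /\
          (forall x, vert G x -> typ G x = m ->
             free_pseudospace m' (induced G (residue G x `&` layers G 0 m'))),
          (* Sigma 3 *)
          (forall x y, vert G x -> vert G y -> meets G 0 x y) /\
          (forall x y, vert G x -> vert G y -> meets G m x y)
        & (* Sigma 4 *)
          (forall a b p b', let s := a :: b :: rcons p b' in
             typ G a = m -> simple_cycle G setT s ->
             detour G 0 0 m' a b b' s) /\
          (forall a b p b', let s := a :: b :: rcons p b' in
             typ G a = 0 -> simple_cycle G setT s ->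
             detour G m 1 m a b b' s)]
    end
  end.

Record Kclass (T : choiceType) (n : nat) (G : tgraph T) : Prop := {
  K_finite : finite_set (vert G);
  K_Lgraph : Lgraph n G;
  K_acyclic : forall i s, 1 <= i <= n -> ~ simple_cycle G (layers G i.-1 i) s;
  K_intersect : forall a a', vert G a -> vert G a' -> a <> a' ->
    meets G 0 a a';
  K_generate : forall a a', vert G a -> vert G a' -> a <> a' ->
    meets G n a a';
  K_down : forall i h a b p b', let s := a :: b :: rcons p b' in
    h.+2 <= i -> typ G a = i -> typ G b = i.-1 -> typ G b' = i.-1 ->
    simple_cycle G (layers G h i) s ->
    detour G h h i.-1 a b b' s;
  K_up : forall i h a b p b', let s := a :: b :: rcons p b' in
    i.+2 <= h -> typ G a = i -> typ G b = i.+1 -> typ G b' = i.+1 ->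
    simple_cycle G (layers G i h) s ->
    detour G h i.+1 h a b b' s
}.

(* The graph induced on A \cup {w} is an elementary strong extension of the
   graph induced on A, both inside the same typed graph G. *)
Definition elementary_strong (T : choiceType) (G : tgraph T)
    (A : set T) (w : T) : Prop :=
  [/\ vert G w, ~ A w
    & (forall u v, A u -> A v -> adj G w u -> adj G w v -> u = v) \/
      (exists x y z, [/\ [set` [:: x; y; z]] `<=` A,
                         dense_flag G x [:: y; z],
                         typ G w = typ G y
                       & forall u, A u -> (adj G w u <-> u = x \/ u = z)])].

(* strong G A B: A <= B, for A and B with the structure induced by G. *)
Inductive strong (T : choiceType) (G : tgraph T) (A : set T) : set T -> Prop :=
| strong_refl : strong G A A
| strong_step B w :
    strong G A B -> elementary_strong G B w -> strong G A (B `|` [set w]).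

Definition embedding (T U : choiceType) (G : tgraph T) (H : tgraph U)
    (f : T -> U) : Prop :=
  [/\ f @` vert G `<=` vert H,
      set_inj (vert G) f,
      forall x, vert G x -> typ H (f x) = typ G x
    & forall x y, vert G x -> vert G y -> adj H (f x) (f y) = adj G x y].

(* M is the union of a chain of finite subsets A i as in the definition of the
   Hrushovski limit of (K_n, <=). The extension C of D is an abstract graph,
   given with an embedding f of D onto a strong subset of C. *)
Definition hrushovski_limit (T : choiceType) (n : nat) (M : tgraph T) : Prop :=
  exists A : nat -> set T,
  [/\ vert M = \bigcup_i A i,
      A 0 = set0,
      forall i, Kclass n (induced M (A i)),
      forall i, strong M (A i) (A i.+1)
    & forall i (D : set T) (U : choiceType) (C : tgraph U) (f : T -> U),
        strong M D (A i) ->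
        Kclass n C -> embedding (induced M D) C f ->
        strong C (f @` D) (vert C) ->
        exists j (g : U -> T),
          [/\ i <= j,
              embedding C (induced M (A j)) g,
              forall x, D x -> g (f x) = x
            & strong M (g @` vert C) (A j)]].

(* Main.v *)
(** The strong extensions of the empty graph are self-dual, and restricting one
    to a convex set of vertices (a range of layers, a residue) yields again a
    strong extension of the empty graph. So axioms on smaller-dimensional
    pieces need no separate treatment, and it suffices to prove, for an
    arbitrary such extension and by induction on the order of adding vertices:
    two vertices with a common lower bound have a greatest one, and any walk
    between two vertices below a can be pushed into R(a) without getting longer
    and without meeting new minimal or maximal vertices (the latter contains
    Sigma 4 and conditions (4) and (5) of K_n). This also shows that every
    one-point strong extension of a member of the chain lies in K_n, so the
    universal property of the limit provides infinitely many neighbours. *)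

From mathcomp Require Import all_boot all_algebra.
From mathcomp Require Import boolp classical_sets functions cardinality.
From mathcomp Require Import zify.
Require Import Defs.

Set Implicit Arguments.
Unset Strict Implicit.
Unset Printing Implicit Defensive.

(** * Constructions, chains and walks for an arbitrary relation *)

Section Relation.
Variables (T : eqType) (c : rel T).

Definition lnk : rel T := fun u v => c u v || c v u.

Lemma lnkC u v : lnk u v = lnk v u.
Proof. exact: orbC. Qed.

(* [w :: s] adds the vertex w to s, for the cover relation [c]. The clauses are
   weaker than being an elementary strong extension, but they are what the
   induction uses, and they are visibly self-dual and stable under convex
   restriction. *)
Fixpoint constructible (s : seq T) : Prop :=
  if s is w :: s' then
    [/\ constructible s', w \notin s',
        {in s' &, forall u v, c w u -> c w v -> u = v},
        {in s' &, forall u v, c u w -> c v w -> u = v}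
      & {in s' &, forall u v, c u w -> c w v ->
           exists2 y, y \in s' & c u y && c y v}]
  else True.

(** The order generated by [c] along chains inside [D]; for the covers of a typed graph these chains
    are the dense flags. *)
Inductive below (D : T -> Prop) : T -> T -> Prop :=
| below_refl x : D x -> below D x x
| below_cons x y z : D x -> c x y -> below D y z -> below D x z.

(** The index only bounds the number of steps, as the constant walk exists at every [n]; a shortened
    walk therefore still fits. *)
Inductive walk (D : T -> Prop) : nat -> T -> T -> Prop :=
| walk_refl n x : D x -> walk D n x x
| walk_cons n x y z : D x -> lnk x y -> walk D n y z -> walk D n.+1 x z.

Local Notation memP s := (fun v => v \in s).

(** [v] need not lie in [D]. In a graded relation its rank is strictly between two ranks occurring
    in [D], which is how the ban on new vertices of extremal type is tracked. *)
Definition interior (D : T -> Prop) (v : T) : Prop :=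
  exists x z, [/\ D x, D z, c x v & c v z].

Lemma below_sub (D D' : T -> Prop) x y :
  (forall v, D v -> D' v) -> below D x y -> below D' x y.
Proof.
move=> DD'; elim=> {x y} [x /DD' Dx|x y z /DD' Dx cxy _]; first exact: below_refl.
exact: below_cons.
Qed.

Lemma below_trans D x y z : below D x y -> below D y z -> below D x z.
Proof.
elim=> {x y} [//|x y y' Dx cxy _ IH] /IH; exact: below_cons.
Qed.

Lemma below_l D x y : below D x y -> D x.
Proof. by case. Qed.

Lemma below_r D x y : below D x y -> D y.
Proof. by elim. Qed.

Lemma below_cov (D : T -> Prop) x y : D x -> D y -> c x y -> below D x y.
Proof. by move=> Dx Dy xy; apply: below_cons xy (below_refl Dy). Qed.

Lemma below_seq (D : T -> Prop) x y : below D x y ->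
  exists2 s : seq T, (forall v, v \in s -> D v) & below (fun v => v \in s) x y.
Proof.
elim=> {x y} [x Dx|x y z Dx cxy _ [s sD sb]].
  by exists [:: x]; [move=> v; rewrite inE => /eqP->|apply: below_refl; rewrite inE].
exists (x :: s); first by move=> v; rewrite inE => /predU1P[->|/sD].
apply: (below_cons (y := y)) => //; first by rewrite inE eqxx.
by apply: below_sub sb => v vs; rewrite inE vs orbT.
Qed.

Lemma walk_sub (D D' : T -> Prop) n x y :
  (forall v, D v -> D' v) -> walk D n x y -> walk D' n x y.
Proof.
move=> DD'; elim=> {n x y} [n x /DD' Dx|n x y z /DD' Dx cxy _]; first exact: walk_refl.
exact: walk_cons.
Qed.

Lemma walk_leq D m n x y : m <= n -> walk D m x y -> walk D n x y.
Proof.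
move=> mn w; elim: w n mn => {m x y} [m x Dx n _|m x y z Dx xy _ IH [//|n] mn].
  exact: walk_refl.
by apply: walk_cons xy _ => //; apply: IH.
Qed.

Lemma walk_l D n x y : walk D n x y -> D x.
Proof. by case. Qed.

Lemma walk_r D n x y : walk D n x y -> D y.
Proof. by elim. Qed.

Lemma walk_inv D n x z : walk D n x z ->
  x = z \/ exists m y, [/\ n = m.+1, lnk x y & walk D m y z].
Proof.
by case=> {n x z} [n x _|n x y z _ xy w]; [left|right; exists n, y].
Qed.

Lemma walk_rcons (D : T -> Prop) n x y z :
  walk D n x y -> lnk y z -> D z -> walk D n.+1 x z.
Proof.
move=> w yz Dz; elim: w yz => {n x y} [n x Dx xz|n x y y' Dx xy _ IH /IH].
  by apply: walk_cons xz _ => //; apply: walk_refl.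
exact: walk_cons.
Qed.

Lemma walk_sym D n x y : walk D n x y -> walk D n y x.
Proof.
elim=> {n x y} [n x Dx|n x y z Dx xy _ IH]; first exact: walk_refl.
by apply: walk_rcons IH _ _ => //; rewrite lnkC.
Qed.

Lemma walk_path (D : T -> Prop) n x y : walk D n x y ->
  exists q, [/\ path lnk x q, last x q = y, size q <= n
              & forall v, v \in x :: q -> D v].
Proof.
elim=> {n x y} [n x Dx|n x y z Dx xy _ [q [qp ql qs qD]]].
  by exists [::]; split=> // v; rewrite inE => /eqP->.
exists (y :: q); split=> //=; first by rewrite xy.
by move=> v; rewrite inE => /predU1P[->|/qD].
Qed.

Lemma path_walk x p :
  path lnk x p -> walk (fun v => v \in x :: p) (size p) x (last x p).
Proof.
elim: p x => [|y p IH] x /=; first by move=> _; apply: walk_refl; rewrite inE.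
case/andP=> xy /IH w; apply: walk_cons xy _; first by rewrite inE eqxx.
by apply: walk_sub w => v vp; rewrite inE vp orbT.
Qed.

(** Only the last clause of [constructible] asserts existence, and convexity keeps its witness [y]
    in the filtered list. *)
Lemma constructible_filter (F : pred T) s : constructible s ->
  {in s & &, forall x y z, c x y -> c y z -> F x -> F z -> F y} ->
  constructible (filter F s).
Proof.
elim: s => [//|w s IH] [cs ws up dn md] cv.
have {}IH : constructible (filter F s).
  by apply: IH => // x y z xs ys zs; apply: cv; rewrite inE ?xs ?ys ?zs orbT.
move=> /=; case: ifP => // Fw; split=> //.
- by rewrite mem_filter (negPf ws) andbF.
- move=> u v; rewrite !mem_filter => /andP[_ us] /andP[_ vs]; exact: up.
- move=> u v; rewrite !mem_filter => /andP[_ us] /andP[_ vs]; exact: dn.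
move=> u v; rewrite !mem_filter => /andP[Fu us] /andP[Fv vs] uw wv.
have [y ys /andP[uy yv]] := md _ _ us vs uw wv.
exists y; rewrite ?uy // mem_filter ys andbT.
by apply: (cv u y v); rewrite ?inE ?us ?ys ?vs ?orbT.
Qed.

(** A finitary form of being constructed that makes sense for infinite sets: the finitely many
    vertices involved in an argument always fit into one construction inside [S]. *)
Definition buildable (S : set T) : Prop :=
  forall s : seq T, (forall v, v \in s -> S v) ->
  exists X, [/\ constructible X, {subset s <= X} & forall v, v \in X -> S v].

End Relation.

Lemma constructible_map (T U : eqType) (c : rel T) (d : rel U) (f : T -> U) s :
  {in s &, injective f} -> {in s &, forall u v, d (f u) (f v) = c u v} ->
  constructible c s -> constructible d (map f s).
Proof.
elim: s => [//|w s IH] fi fc [cs ws up dn md].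
have ms : forall u, u \in s -> u \in w :: s by move=> u; rewrite inE orbC => ->.
have mw : w \in w :: s by rewrite inE eqxx.
split.
- by apply: IH => // u v us vs; [apply: fi|apply: fc]; apply: ms.
- apply/mapP => -[v vs wv]; move: ws.
  by rewrite (fi _ _ mw (ms _ vs) wv) vs.
- move=> _ _ /mapP[u us ->] /mapP[v vs ->];
  rewrite !fc ?(mw, ms _ us, ms _ vs) // => wu wv.
  by rewrite (up u v).
- move=> _ _ /mapP[u us ->] /mapP[v vs ->];
  rewrite !fc ?(mw, ms _ us, ms _ vs) // => wu wv.
  by rewrite (dn u v).
move=> _ _ /mapP[u us ->] /mapP[v vs ->];
  rewrite !fc ?(mw, ms _ us, ms _ vs) // => uw wv.
have [y ys yP] := md _ _ us vs uw wv.
by exists (f y); [exact: map_f|rewrite !fc ?(ms _ ys, ms _ us, ms _ vs)].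
Qed.

Definition flip (T : Type) (c : rel T) : rel T := fun u v => c v u.

Lemma constructible_flip (T : eqType) (c : rel T) s :
  constructible c s -> constructible (flip c) s.
Proof.
elim: s => [//|w s IH] [cs ws up dn md]; split=> //; first exact: IH.
move=> u v us vs uw wv; have [y ys yP] := md v u vs us wv uw.
by exists y; rewrite // andbC.
Qed.

Local Notation memP s := (fun v => v \in s).

(** * Meets, walks below a vertex and cycles in graded constructions *)

Section Graded.
Variables (T : eqType) (c : rel T) (r : T -> int).
Hypothesis rP : forall u v, c u v -> (r v = r u + 1)%R.

Local Notation below := (below c).
Local Notation walk := (walk c).
Local Notation lnk := (lnk c).
Local Notation interior := (interior c).
Local Notation buildable := (buildable c).

Lemma below_rank D x y : below D x y -> (r x <= r y)%R.
Proof. by elim=> [//|u v w _ /rP]; lia. Qed.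

Lemma below_anti D x y : below D x y -> (r y <= r x)%R -> x = y.
Proof. by case=> // u v w _ /rP + /below_rank; lia. Qed.

Lemma walk_rank D n x y : walk D n x y -> (r y <= r x + n%:Z)%R.
Proof.
elim=> [*|m u v w _ uv _]; first by lia.
by case/orP: uv => /rP; lia.
Qed.

(** Each step up a chain raises the rank by one, so the length is the rank difference; a vertex
    strictly inside the chain is interior because both its chain neighbours are in [D]. *)
Lemma below_walk D x y : below D x y ->
  exists2 k, (r y = r x + k%:Z)%R
    & walk (fun v => below D v y /\ (v = x \/ v = y \/ interior D v)) k x y.
Proof.
elim=> {x y} [x Dx|x y z Dx xy b [k rk w]].
  exists 0; [lia|by apply: walk_refl; split; [exact: below_refl|left]].
exists k.+1; first by move/rP: xy; lia.
apply: (walk_cons (y := y)); rewrite /lnk ?xy //.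
  by split; [exact: below_cons xy b|left].
apply: walk_sub w => v [bv iv]; split=> //; case: iv => [vy|[->|iv]].
- subst v; case: b Dx xy {bv rk} => [u Du|u v w Du uv b] Dx xu.
    by right; left.
  by right; right; exists x, v; split=> //; exact: below_l b.
- by right; left.
- by right; right.
Qed.

(** A step of a walk changes the rank by one, so no walk is shorter than a chain with the same
    ends. *)
Lemma below_geodesic D n x y : below D x y -> walk D n x y ->
  walk (fun v => below D v y /\ (v = x \/ v = y \/ interior D v)) n x y.
Proof.
move=> b w; have [k rk w'] := below_walk b.
apply: walk_leq w'; move/walk_rank: w; lia.
Qed.

Section Extend.
Variables (w : T) (s : seq T).
Hypothesis cws : constructible c (w :: s).

Local Notation Ds := (memP s).
Local Notation Dw := (memP (w :: s)).

Let ws : w \notin s. Proof. by case: cws. Qed.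

Let up : {in s &, forall u v, c w u -> c w v -> u = v}.
Proof. by case: cws. Qed.

Let dn : {in s &, forall u v, c u w -> c v w -> u = v}.
Proof. by case: cws. Qed.

Let md : {in s &, forall u v, c u w -> c w v ->
           exists2 y, y \in s & c u y && c y v}.
Proof. by case: cws. Qed.

Let neqw v : v \in s -> v != w.
Proof. by apply: contraTneq => ->. Qed.

Let covww v : c w v -> v \in w :: s -> v \in s.
Proof. by move=> wv; rewrite inE => /predU1P[vw|//]; subst v; move/rP: wv; lia. Qed.

Lemma below_extend x y : below Ds x y -> below Dw x y.
Proof. by apply: below_sub => v vs; rewrite inE vs orbT. Qed.

(** Where a chain crosses [w] between two vertices of [s], the last clause of [constructible]
    supplies a replacement for [w]. A chain that starts at [w] leaves it through an upper neighbour
    in [s]. *)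
Lemma below_restrict x y : below Dw x y -> y \in s ->
  (x \in s -> below Ds x y) /\
  (x = w -> exists u, [/\ u \in s, c w u & below Ds u y]).
Proof.
elim=> {x y} [x Dx xs|x y z Dx xy b IH zs].
  by split=> [_|xw]; [exact: below_refl|rewrite xw (negPf ws) in xs].
have [IH1 IH2] := IH zs; move: (below_l b); rewrite /= inE => yDw.
split=> [xs|xw].
  case/predU1P: yDw => [yw|ys]; last exact: below_cons (IH1 ys).
  have [u [us wu bu]] := IH2 yw; rewrite yw in xy.
  have [v vs /andP[xv vu]] := md xs us xy wu.
  by apply: below_cons xv _ => //; apply: below_cons vu _.
subst x; have ys := covww xy yDw.
by exists y; split=> //; apply: IH1.
Qed.

Lemma below_new x : below Dw x w -> x != w ->
  exists u, [/\ u \in s, c u w & below Ds x u].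
Proof.
suff gen z : below Dw x z -> z = w -> x != w ->
    exists u, [/\ u \in s, c u w & below Ds x u] by move/gen; apply.
elim=> {x z} [x _ ->|x y z Dx xy b IH zw xw]; first by rewrite eqxx.
have xs : x \in s by move: Dx; rewrite /= inE (negPf xw).
have [yw|yw] := eqVneq y w.
  by exists x; split=> //; [rewrite -yw|exact: below_refl].
have [u [us uw yu]] := IH zw yw.
by exists u; split=> //; apply: below_cons yu.
Qed.

(* A detour through w either backtracks or passes between two neighbours
   u < w < v, and can then use the vertex y with u < y < v instead of w. *)
Lemma walk_restrict (D : T -> Prop) n x y :
  (forall v, D v -> v \in w :: s) -> x \in s -> y \in s -> walk D n x y ->
  walk (fun v => v \in s /\ (D v \/ interior Ds v)) n x y.
Proof.
(* Strong induction, since a passage through [w] uses up two steps at once. *)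
move=> Dws + ys wk; elim/ltn_ind: n x wk => n IH x wk xs.
case: wk IH xs ys => {n x y} [n x Dx|n x y z Dx xy wk] IH xs zs.
  by apply: walk_refl; split; [|left].
have [yw|yw] := eqVneq y w; last first.
  apply: walk_cons xy _; first by split; [|left].
  apply: IH => //; have /Dws := walk_l wk.
  by rewrite inE (negPf yw).
subst y; case/walk_inv: wk => [wz|[m [v [nm uv wk]]]].
  by rewrite -wz (negPf ws) in zs.
subst n.
have vs : v \in s.
  have := Dws _ (walk_l wk); rewrite inE => /predU1P[vw|//].
  by subst v; case/orP: uv => /rP; lia.
have wkv : walk (fun v => v \in s /\ (D v \/ interior Ds v)) m v z.
  by apply: IH => //; lia.
have [<-|xv] := eqVneq v x; first by apply: walk_leq wkv; lia.
have [y [ys iy xy' yv]] : exists y, [/\ y \in s, interior Ds y, lnk x y & lnk y v].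
  rewrite /lnk; case/orP: xy uv => xw /orP[] wv.
  - have [y ys /andP[xy yv]] := md xs vs xw wv.
    by exists y; split; rewrite ?xy ?yv //; exists x, v.
  - by rewrite (dn xs vs xw wv) eqxx in xv.
  - by rewrite (up xs vs xw wv) eqxx in xv.
  have [y ys /andP[vy yx]] := md vs xs wv xw.
  by exists y; split; rewrite ?vy ?yx ?orbT //; exists v, x.
apply: (walk_cons _ xy'); first by split; [|left].
by apply: (walk_cons _ yv wkv); split; [|right].
Qed.

(** The upper neighbour of [w] is unique, so the chain from [w] to [a] passes through it; a lower
    neighbour of [w] lies below it via the vertex that replaces [w]. *)
Lemma lnk_new_below a v : below Dw w a -> a \in s -> v \in s -> lnk w v ->
  below Ds v a.
Proof.
move=> b as_ vs; have [_ /(_ erefl)[u [us wu ua]]] := below_restrict b as_.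
case/orP=> [wv|vw]; first by rewrite (up vs us wv wu).
have [y ys /andP[vy yu]] := md vs us vw wu.
by apply: below_cons vy _ => //; apply: below_cons yu _.
Qed.

Lemma interior_extend v : interior Ds v -> interior Dw v.
Proof.
by case=> x [z [xs zs xv vz]]; exists x, z; split; rewrite //= inE ?xs ?zs orbT.
Qed.

End Extend.

(** Induction on the newest vertex [w]. If [w] is one of the two vertices and not below the other,
    every common lower bound lies below the unique lower neighbour of [w], which can take its place.
    If [w] is neither, it matters only as a lower bound, and then its unique upper neighbour is an
    older common lower bound above it, so the old meet survives. *)
Lemma constructible_meet s x y : constructible c s ->
  (exists v, below (memP s) v x /\ below (memP s) v y) ->
  exists z, [/\ below (memP s) z x, below (memP s) z y
    & forall v, below (memP s) v x -> below (memP s) v y -> below (memP s) v z].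
Proof.
elim: s x y => [|w s IH] x y cws [v [vx vy]]; first by move/below_l: vx.
have cs : constructible c s by case: cws.
have new_l y' v' : below (memP (w :: s)) v' w -> below (memP (w :: s)) v' y' ->
  y' \in w :: s ->
  exists z, [/\ below (memP (w :: s)) z w, below (memP (w :: s)) z y'
    & forall v, below (memP (w :: s)) v w -> below (memP (w :: s)) v y' ->
        below (memP (w :: s)) v z].
  move=> vw vy' y's; have [wy|nwy] := pselect (below (memP (w :: s)) w y').
    by exists w; split=> //; apply: below_refl; rewrite /= inE eqxx.
  have y's' : y' \in s.
    move: y's; rewrite inE => /predU1P[yw|//]; case: nwy.
    by rewrite yw; apply: below_refl; rewrite /= inE eqxx.
  have nw v1 : below (memP (w :: s)) v1 y' -> v1 != w.
    by move=> b; apply: contra_notN nwy => /eqP v1w; rewrite v1w in b.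
  have [u [us uw v'u]] := below_new vw (nw _ vy').
  have Dsy v1 : below (memP (w :: s)) v1 y' -> below (memP s) v1 y'.
    move=> b; apply: (below_restrict cws b y's').1.
    by have := below_l b; rewrite /= inE (negPf (nw _ b)).
  have [|z [zu zy zM]] := IH u y' cs; first by exists v'; split=> //; apply: Dsy.
  exists z; split; [|exact: below_extend|].
    apply: (below_trans (below_extend _ zu)).
    by apply: below_cov uw; rewrite /= inE ?us ?eqxx ?orbT.
  move=> v1 v1w v1y; apply: below_extend; apply: zM; last exact: Dsy.
  have [u' [us' uw' v'u']] := below_new v1w (nw _ v1y).
  by case: cws => _ _ _ /(_ _ _ us us' uw uw') ->.
have xs := below_r vx; have ys := below_r vy.
have [xw|xw] := eqVneq x w; first by subst x; apply: new_l vx vy ys.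
have [yw|yw] := eqVneq y w.
  subst y; have [z [? ? zM]] := new_l _ _ vy vx xs.
  by exists z; split=> // v1 ? ?; apply: zM.
have {xw}xs : x \in s by move: xs; rewrite /= inE (negPf xw).
have {yw}ys : y \in s by move: ys; rewrite /= inE (negPf yw).
have lift v1 : below (memP (w :: s)) v1 x -> below (memP (w :: s)) v1 y ->
  exists2 v2, below (memP s) v2 x /\ below (memP s) v2 y &
   (v1 = v2 \/ v1 = w /\ c w v2).
  move=> v1x v1y; have [Rx Rx'] := below_restrict cws v1x xs.
  have [Ry Ry'] := below_restrict cws v1y ys.
  have := below_l v1x; rewrite /= inE => /predU1P[v1w|v1s].
    have [u [us wu ux]] := Rx' v1w; have [u' [us' wu' uy']] := Ry' v1w.
    exists u; last by right.
    by split=> //; case: cws => _ _ /(_ _ _ us us' wu wu') ->.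
  by exists v1; [split; [exact: Rx|exact: Ry]|left].
have [v2 v2xy _] := lift _ vx vy.
have [|z [zx zy zM]] := IH x y cs; first by exists v2.
exists z; split; [exact: below_extend|exact: below_extend|].
move=> v1 v1x v1y; have [v3 [v3x v3y] [->|[-> wv3]]] := lift _ v1x v1y.
  by apply: below_extend; apply: zM.
apply: (below_trans _ (below_extend _ (zM _ v3x v3y))).
apply: below_cov wv3; rewrite /= inE ?eqxx //.
by rewrite (below_l v3x) orbT.
Qed.

(* If the new vertex w is an end of the walk and lies below a, then all its
   neighbours lie below a; otherwise w can be avoided by [walk_restrict]. If
   w = a, everything below a except a is below its unique lower neighbour. *)
Lemma residue_walk s a b b' (D : T -> Prop) n : constructible c s ->
  (forall v, D v -> v \in s) ->
  below (memP s) b a -> below (memP s) b' a -> walk D n b b' ->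
  walk (fun v => below (memP s) v a /\ (D v \/ interior (memP s) v)) n b b'.
Proof.
elim: s a b b' D n => [|w s IH] a b b' D n cws Ds ba b'a wk.
  by move/below_l: ba.
have cs : constructible c s by case: cws.
have Db := walk_l wk; have Db' := walk_r wk.
(* Comparable ends are settled first, by the chain between them. Afterwards, if [a] is [w], neither
   end can be [w]. *)
have comp x y k : below (memP (w :: s)) x y -> below (memP (w :: s)) y a ->
    D x -> D y -> walk D k x y ->
    walk (fun v => below (memP (w :: s)) v a /\
                   (D v \/ interior (memP (w :: s)) v)) k x y.
  move=> xy ya Dx Dy /(walk_sub Ds)/(below_geodesic xy).
  apply: walk_sub => v [vy iv]; split; first exact: below_trans ya.
  by case: iv => [->|[->|iv]]; [left|left|right].
have [bb'|nbb'] := pselect (below (memP (w :: s)) b b'); first exact: comp.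
have [b'b|nb'b] := pselect (below (memP (w :: s)) b' b).
  by apply: walk_sym; apply: comp => //; apply: walk_sym.
have [aw|aw] := eqVneq a w.
  subst a.
  have bw : b != w by apply: contra_notN nb'b => /eqP ->.
  have b'w : b' != w by apply: contra_notN nbb' => /eqP ->.
  have [u [us uw bu]] := below_new ba bw.
  have [u' [us' uw' bu']] := below_new b'a b'w.
  have uu' : u' = u by case: cws => _ _ _ /(_ _ _ us' us uw' uw) ->.
  rewrite {}uu' in bu' {us' uw'}.
  have := walk_restrict cws Ds (below_l bu) (below_l bu') wk.
  move/(IH _ _ _ _ _ cs (fun v => @proj1 _ _) bu bu'); apply: walk_sub => v [vu iv].
  split.
    apply: (below_trans (below_extend _ vu)).
    by apply: below_cov uw; rewrite /= inE ?us ?eqxx ?orbT.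
  by case: iv => [[vs [|]]|]; [left|right; exact: interior_extend..].
have as_ : a \in s by have := below_r ba; rewrite /= inE (negPf aw).
have old x y D' k : x \in s -> y \in s -> (forall v, D' v -> D v) ->
   below (memP s) x a -> below (memP s) y a -> walk D' k x y ->
   walk (fun v => below (memP (w :: s)) v a /\
                   (D v \/ interior (memP (w :: s)) v)) k x y.
  move=> xs ys D'D xa ya /(walk_sub D'D)/(walk_restrict cws Ds xs ys).
  move/(IH _ _ _ _ _ cs (fun v => @proj1 _ _) xa ya); apply: walk_sub => v [va iv].
  split; first exact: below_extend.
  by case: iv => [[vs [|]]|]; [left|right; exact: interior_extend..].
(* After its first step the walk is at a vertex of [s] below [a], and [old] treats the rest. *)
have new y k : y \in s -> below (memP s) y a -> below (memP (w :: s)) w a ->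
   walk D k w y ->
   walk (fun v => below (memP (w :: s)) v a /\
                   (D v \/ interior (memP (w :: s)) v)) k w y.
  move=> ys ya wa wky; case: (walk_inv wky) => [wy|[m [v [-> uv wk']]]].
    by case: cws => _; rewrite wy ys.
  have vs : v \in s.
    have := Ds _ (walk_l wk'); rewrite inE => /predU1P[vw|//].
    by subst v; case/orP: uv => /rP; lia.
  apply: (walk_cons _ uv); first by split; [|left; exact: walk_l wky].
  have va := lnk_new_below cws wa as_ vs uv.
  exact: (old v y D).
have bDs x : below (memP (w :: s)) x a -> x != w -> below (memP s) x a.
  move=> xa xw; apply: (below_restrict cws xa as_).1.
  by have := below_l xa; rewrite /= inE (negPf xw).
have [bw|bw] := eqVneq b w.
  subst b; have b'w : b' != w.
    by apply: contra_notN nbb' => /eqP->; apply: below_refl; exact: Ds Db.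
  have b'a' := bDs _ b'a b'w.
  exact: new (below_l b'a') b'a' ba wk.
have [b'w|b'w] := eqVneq b' w.
  subst b'; have ba' := bDs _ ba bw.
  by apply: walk_sym; exact: new (below_l ba') ba' b'a (walk_sym wk).
have {ba}ba := bDs _ ba bw; have {b'a}b'a := bDs _ b'a b'w.
apply: (old b b' D) => //; [exact: below_l ba|exact: below_l b'a].
Qed.

(** The newest vertex on the cycle has two distinct older neighbours. Both above it or both below it
    contradicts uniqueness of such neighbours; one on each side makes it interior. *)
Lemma constructible_acyclic s t : constructible c s -> (forall v, ~ interior (memP s) v) ->
  cycle lnk t -> uniq t -> 2 < size t -> ~ {subset t <= s}.
Proof.
elim: s t => [|w s IH] t cws ni ct ut st ts.
  by case: t st ts {ct ut} => // x t _ /(_ x); rewrite inE eqxx => /(_ isT).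
have cs : constructible c s by case: cws.
have [wt|wt] := boolP (w \in t); last first.
  apply: (IH t) => //; first by move=> v /(interior_extend w)/ni.
  move=> v vt; have := ts v vt; rewrite inE => /predU1P[vw|//].
  by rewrite vw (negPf wt) in vt.
have [i t' Et] := rot_to wt.
have {}ct : cycle lnk (w :: t') by rewrite -Et rot_cycle.
have {}ut : uniq (w :: t') by rewrite -Et rot_uniq.
have {}ts : {subset w :: t' <= w :: s} by move=> v; rewrite -Et mem_rot => /ts.
have {}st : 2 < size (w :: t') by rewrite -Et size_rot.
case: t' {Et} ct ut ts st => // u; elim/last_ind => // t' v _ /=.
rewrite rcons_path last_rcons => /and3P[wu _ vw] ut ts _.
have us : u \in s.
  have := ts u; rewrite !inE eqxx orbT => /(_ isT)/predU1P[uw|//].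
  by move: ut; rewrite uw inE eqxx.
have vs : v \in s.
  have := ts v; rewrite !(inE, mem_rcons) eqxx !orbT => /(_ isT)/predU1P[vw'|//].
  by move: ut; rewrite vw' !(inE, mem_rcons) eqxx orbT.
have uv : u != v.
  by case/and3P: ut => _ + _; apply: contraNneq => ->; rewrite mem_rcons inE eqxx.
case: cws => _ _ up dn md.
have sw z : z \in s -> z \in w :: s by rewrite inE orbC => ->.
have ww : w \in w :: s by rewrite inE eqxx.
case/orP: wu vw => uw /orP[] vw.
- by apply: (ni w); exists v, u; split=> //; exact: sw.
- by rewrite (up u v us vs uw vw) eqxx in uv.
- by rewrite (dn u v us vs uw vw) eqxx in uv.
- by apply: (ni w); exists u, v; split=> //; exact: sw.
Qed.

(** Meets computed in different finite constructions could differ, so [z] is chosen as a common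
    lower bound of greatest rank in all of [S]. In a construction containing chains for [z] and a
    competitor [v], the meet lies above [z], hence equals [z], and lies above [v]. *)
Lemma buildable_meet (S : set T) x y : buildable S ->
  (exists v, below S v x /\ below S v y) ->
  exists z, [/\ below S z x, below S z y
    & forall v, below S v x -> below S v y -> below S v z].
Proof.
move=> bS [v0 [v0x v0y]].
pose P k := `[< exists v, [/\ below S v x, below S v y & absz (r x - r v)%R = k] >].
have exP : exists k, P k.
  by exists (absz (r x - r v0)%R); apply/asboolP; exists v0.
case: (ex_minnP exP) => k /asboolP[z [zx zy zk]] min.
exists z; split=> // v vx vy.
have [s1 s1S b1] := below_seq zx; have [s2 s2S b2] := below_seq zy.
have [s3 s3S b3] := below_seq vx; have [s4 s4S b4] := below_seq vy.
have [|X [cX sX XS]] := bS (s1 ++ s2 ++ s3 ++ s4).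
  by move=> u; rewrite !mem_cat => /or4P[/s1S|/s2S|/s3S|/s4S].
have inX s u w : {subset s <= s1 ++ s2 ++ s3 ++ s4} ->
    below (memP s) u w -> below (memP X) u w.
  by move=> ss; apply: below_sub => t /ss/sX.
move: b1 b2 b3 b4 => /inX b1 /inX b2 /inX b3 /inX b4.
have {}b1 : below (memP X) z x by apply: b1 => u us; rewrite !mem_cat us.
have {}b2 : below (memP X) z y by apply: b2 => u us; rewrite !mem_cat us orbT.
have {}b3 : below (memP X) v x by apply: b3 => u us; rewrite !mem_cat us !orbT.
have {}b4 : below (memP X) v y by apply: b4 => u us; rewrite !mem_cat us !orbT.
have [|z' [z'x z'y z'M]] := constructible_meet cX (x := x) (y := y); first by exists z.
have zz' := z'M _ b1 b2; have vz' := z'M _ b3 b4.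
have : P (absz (r x - r z')%R).
  by apply/asboolP; exists z'; split=> //; apply: below_sub XS _.
move/min; have := below_rank zz'; have := below_rank z'x; rewrite -zk => rz'x rzz' rr.
have -> : z = z' by apply: (below_anti zz'); lia.
exact: below_sub XS vz'.
Qed.

(** The part of the cycle avoiding [a] is a walk with both ends below [a], so [residue_walk] applies
    in a finite construction. As [a] is maximal in [S], it is not interior and the new walk still
    avoids it. *)
Lemma buildable_detour (S : set T) a b p b' : buildable S -> S a ->
  (forall z, S z -> ~~ c a z) -> c b a -> c b' a ->
  (forall v, v \in b :: rcons p b' -> S v) -> path lnk b (rcons p b') ->
  a \notin b :: rcons p b' ->
  exists q, [/\ path lnk b q, last b q = b', size q <= (size p).+1
    & forall v, v \in b :: q -> [/\ below S v a, v <> a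
        & v \in b :: rcons p b' \/ interior S v]].
Proof.
move=> bS Sa topa ba b'a tS pt at_; set t := b :: rcons p b' in tS at_ *.
have [|X [cX sX XS]] := bS (a :: t).
  by move=> v; rewrite inE => /predU1P[->|/tS].
have aX : a \in X by apply: sX; rewrite inE eqxx.
have tX v : v \in t -> v \in X by move=> vt; apply: sX; rewrite inE vt orbT.
have bt : b \in t by rewrite inE eqxx.
have b't : b' \in t by rewrite inE mem_rcons inE eqxx orbT.
have := path_walk pt; rewrite last_rcons size_rcons => wk.
have := residue_walk cX tX (below_cov (D := memP X) (tX _ bt) aX ba)
  (below_cov (D := memP X) (tX _ b't) aX b'a) wk.
move/walk_path => [q [qp ql qs qD]]; exists q; split=> // v /qD[va iv].
have iS : interior (memP X) v -> interior S v.
  by case=> x [z [xX zX xv vz]]; exists x, z; split=> //; apply: XS.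
split; first exact: below_sub XS va.
  move=> E; case: iv => [|/iS[_ [z [_ Sz _]]]]; rewrite E; first exact/negP.
  exact/negP/topa.
by case: iv => [|/iS]; [left|right].
Qed.

Lemma buildable_acyclic (S : set T) t : buildable S ->
  (forall v, ~ interior S v) -> cycle lnk t -> uniq t -> 2 < size t ->
  ~ (forall v, v \in t -> S v).
Proof.
move=> bS ni ct ut st tS; have [X [cX sX XS]] := bS t tS.
apply: (constructible_acyclic cX _ ct ut st sX) => v [x [z [xX zX xv vz]]].
by apply: (ni v); exists x, z; split=> //; apply: XS.
Qed.

End Graded.

(** * Convex restriction and duality for buildable sets *)

Lemma buildable_sub (T : eqType) (c : rel T) (S F : set T) :
  buildable c S ->
  (forall x y z, S x -> S y -> S z -> c x y -> c y z -> F x -> F z -> F y) ->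
  buildable c (fun v => S v /\ F v).
Proof.
move=> bS cv s sSF; have [|X [cX sX XS]] := bS s; first by move=> v /sSF[].
exists (filter (fun v => `[< F v >]) X); split.
- apply: constructible_filter => // x y z xX yX zX xy yz /asboolP Fx /asboolP Fz.
  by apply/asboolP; apply: (cv x y z) => //; apply: XS.
- by move=> v vs; rewrite mem_filter sX // andbT; apply/asboolP; case: (sSF v vs).
by move=> v; rewrite mem_filter => /andP[/asboolP ? /XS].
Qed.

Lemma buildable_eq (T : eqType) (c d : rel T) (S : set T) :
  (forall u v, S u -> S v -> d u v = c u v) -> buildable c S -> buildable d S.
Proof.
move=> cd bS s /bS[X [cX sX XS]]; exists X; split=> //.
by rewrite -(map_id X); apply: constructible_map cX => // u v /XS Su /XS Sv; apply: cd.
Qed.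

Lemma buildable_flip (T : eqType) (c : rel T) (S : set T) :
  buildable c S -> buildable (flip c) S.
Proof.
by move=> bS s /bS[X [cX sX XS]]; exists X; split=> //; apply: constructible_flip.
Qed.

Lemma below_flip (T : eqType) (c : rel T) D x y :
  below (flip c) D x y -> below c D y x.
Proof.
elim=> {x y} [x Dx|x y z Dx yx _ IH]; first exact: below_refl.
exact: below_trans IH (below_cov (c := c) (below_r IH) Dx yx).
Qed.

Lemma lnk_flip (T : eqType) (c : rel T) : lnk (flip c) =2 lnk c.
Proof. by move=> u v; exact: orbC. Qed.

(** * Typed graphs: incidence as an order, intersections, detours and cycles *)

Section TypedGraph.
Variable T : choiceType.
Implicit Types (G : tgraph T) (x y z : T).

Definition cov G : rel T := fun u v => adj G u v && (typ G v == (typ G u).+1).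

Lemma cov_typ G u v : cov G u v -> typ G v = (typ G u).+1.
Proof. by case/andP=> _ /eqP. Qed.

Definition rank G x : int := Posz (typ G x).
(** Grades the flipped cover relation, so that dual statements are instances of the primal ones;
    this is why ranks are integers. *)
Definition corank G x : int := (- Posz (typ G x))%R.

Lemma cov_rank G u v : cov G u v -> (rank G v = rank G u + 1)%R.
Proof. by move/cov_typ => uv; rewrite /rank uv; lia. Qed.

Lemma flip_cov_rank G u v :
  flip (cov G) u v -> (corank G v = corank G u + 1)%R.
Proof. by move/cov_typ => vu; rewrite /corank vu; lia. Qed.

Lemma below_typ G D x y : below (cov G) D x y -> typ G x <= typ G y.
Proof. by move/(below_rank (@cov_rank G)); rewrite /rank; lia. Qed.

Lemma below_typ_eq G D x y :
  below (cov G) D x y -> typ G y <= typ G x -> x = y.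
Proof.
by move=> b le; apply: (below_anti (@cov_rank G) b); rewrite /rank; lia.
Qed.

Lemma dense_flag_below G x y :
  (exists2 p, dense_flag G x p & last x p = y) <->
  below (cov G) (vert G) x y.
Proof.
split=> [[p [pp pG] <-]|].
  elim: p x pp pG => [|y' p IH] x /= pp pG.
    by apply: below_refl; apply: pG; rewrite /= inE.
  case/andP: pp => xy pp; apply: (@below_cons _ (cov G) _ _ y' _ _ xy).
    by apply: pG; rewrite /= inE eqxx.
  by apply: IH => // v vp; apply: pG; rewrite /= inE [_ \in _]vp orbT.
elim=> {x y} [x Gx|x y z Gx xy _ [p [pp pG] <-]].
  by exists [::] => //; split=> // v; rewrite /= inE => /eqP->.
exists (y :: p) => //; split; first by rewrite /= pp andbT.
by move=> v; rewrite /= inE => /predU1P[->//|]; apply: pG.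
Qed.

Lemma residueE G x v : residue G x v <->
  below (cov G) (vert G) x v \/ below (cov G) (vert G) v x.
Proof.
by split=> -[/dense_flag_below|/dense_flag_below]; [left|right|left|right].
Qed.

Record layered lo hi G : Prop := Layered {
  layered_typ : forall x, vert G x -> lo <= typ G x <= hi;
  layered_sym : forall x y, vert G x -> vert G y -> adj G x y -> adj G y x;
  layered_adj : forall x y, vert G x -> vert G y -> adj G x y ->
    typ G y = (typ G x).+1 \/ typ G x = (typ G y).+1 }.

Lemma layered_Lgraph n G : layered 0 n G <-> Lgraph n G.
Proof.
split=> [[t s a]|[t s a]]; first by split=> // x /t.
by split=> // x /t ->.
Qed.

Lemma adj_lnk lo hi G u v :
  layered lo hi G -> vert G u -> vert G v -> adj G u v = lnk (cov G) u v.
Proof.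
move=> [_ s a] Gu Gv; rewrite /lnk /cov; apply/idP/idP.
  by move=> uv; rewrite uv (s _ _ Gu Gv uv); case: (a _ _ Gu Gv uv) => ->;
     rewrite eqxx ?orbT.
by case/orP=> /andP[// vu _]; apply: s.
Qed.

(** Incidence is symmetric, but at the lowest type the chain can only go up from [v], unless [v] and
    [x] coincide. *)
Lemma shadow_bot lo hi G x v : layered lo hi G ->
  shadow G lo x v <-> typ G v = lo /\ below (cov G) (vert G) v x.
Proof.
move=> lG; split=> [[/residueE xv [Gv tv]]|[tv vx]].
  have {}tv : typ G v = lo by lia.
  split=> //; case: xv => // xv; have Gx := below_l xv.
  rewrite (below_typ_eq xv) ?tv; first exact: below_refl.
  by case/andP: (layered_typ lG Gx).
by split; [apply/residueE; right|split; [exact: below_l vx|lia]].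
Qed.

Lemma shadow_top lo hi G x v : layered lo hi G ->
  shadow G hi x v <-> typ G v = hi /\ below (cov G) (vert G) x v.
Proof.
move=> lG; split=> [[/residueE xv [Gv tv]]|[tv vx]].
  have {}tv : typ G v = hi by lia.
  split=> //; case: xv => // vx; have Gx := below_r vx.
  rewrite (below_typ_eq vx) ?tv; first exact: below_refl.
  by case/andP: (layered_typ lG Gx).
by split; [apply/residueE; left|split; [exact: below_r vx|lia]].
Qed.

(** The greatest lower bound serves as the intersection: vertices of type [lo] below both are
    exactly those below it. Without a common lower bound the shadows are disjoint. *)
Lemma meets_bot lo hi G x y : layered lo hi G ->
  buildable (cov G) (vert G) -> meets G lo x y.
Proof.
move=> lG bG; have [|no] := pselect (exists v,
  below (cov G) (vert G) v x /\ below (cov G) (vert G) v y); last right.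
  move/(buildable_meet (@cov_rank G) bG) => [z [zx zy zM]]; left.
  exists z; first exact: below_l zx.
  apply/seteqP; split=> v /=.
    move=> [/(shadow_bot _ _ lG)[tv vx] /(shadow_bot _ _ lG)[_ vy]].
    by apply/(shadow_bot _ _ lG); split=> //; apply: zM.
  move=> /(shadow_bot _ _ lG)[tv vz].
  by split; apply/(shadow_bot _ _ lG); split=> //; apply: below_trans vz _.
apply/seteqP; split=> v //= [/(shadow_bot _ _ lG)[_ vx] /(shadow_bot _ _ lG)[_ vy]].
by apply: no; exists v.
Qed.

(** Dual argument: the least upper bound is a meet for the flipped relation. *)
Lemma meets_top lo hi G x y : layered lo hi G ->
  buildable (cov G) (vert G) -> meets G hi x y.
Proof.
move=> lG bG; have flipK := fun a b => @below_flip _ (flip (cov G)) (vert G) a b.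
have [|no] := pselect (exists v,
  below (flip (cov G)) (vert G) v x /\ below (flip (cov G)) (vert G) v y); last right.
  move/(buildable_meet (@flip_cov_rank G) (buildable_flip bG)).
  case=> z [zx zy zM]; left.
  exists z; first exact: below_l zx.
  apply/seteqP; split=> v /=.
    move=> [/(shadow_top _ _ lG)[tv vx] /(shadow_top _ _ lG)[_ vy]].
    by apply/(shadow_top _ _ lG); split=> //; apply: below_flip; apply: zM; apply: flipK.
  move=> /(shadow_top _ _ lG)[tv vz].
  split; apply/(shadow_top _ _ lG); split=> //; apply: below_trans vz;
    exact: below_flip.
apply/seteqP; split=> v //= [/(shadow_top _ _ lG)[_ vx] /(shadow_top _ _ lG)[_ vy]].
by apply: no; exists v; split; apply: flipK.
Qed.

Lemma layers_vert G i j v : layers G i j v -> vert G v.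
Proof. by case. Qed.

Lemma simple_cycle_split G D a b p b' : simple_cycle G D (a :: b :: rcons p b') ->
  [/\ adj G a b, adj G b' a, path (adj G) b (rcons p b'),
      a \notin b :: rcons p b' & forall v, v \in a :: b :: rcons p b' -> D v].
Proof.
case=> /= /andP[ab]; rewrite rcons_path last_rcons => /andP[pt b'a] /andP[at_ _] _ sD.
by split=> // v /sD[].
Qed.

Lemma path_adj lo hi G x p : layered lo hi G ->
  (forall v, v \in x :: p -> vert G v) -> path (adj G) x p = path (lnk (cov G)) x p.
Proof.
move=> lG pG; apply: (@eq_in_path _ (mem (x :: p))); last exact/allP.
by move=> u v /pG Gu /pG Gv; exact: adj_lnk lG Gu Gv.
Qed.

(** Inside the layers [h] to [i] the vertex [a] has top type, so its neighbours on the cycle lie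
    below it and [buildable_detour] applies. *)
Lemma detour_down lo hi G i h a b p b' : layered lo hi G ->
  buildable (cov G) (layers G h i) -> typ G a = i ->
  simple_cycle G (layers G h i) (a :: b :: rcons p b') ->
  detour G h h i.-1 a b b' (a :: b :: rcons p b').
Proof.
move=> lG bG ta /simple_cycle_split[ab b'a pt at_ sD].
set t := b :: rcons p b' in at_ sD *.
have tD v : v \in t -> layers G h i v by move=> vt; apply: sD; rewrite inE vt orbT.
have aD : layers G h i a by apply: sD; rewrite inE eqxx.
have top z : layers G h i z -> ~~ cov G a z.
  by move=> [_ tz]; apply: contraL tz => /cov_typ ->; rewrite ta; lia.
have bt : b \in t by rewrite inE eqxx.
have b't : b' \in t by rewrite inE mem_rcons inE eqxx orbT.
have toa v : v \in t -> lnk (cov G) a v -> cov G v a.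
  by move=> /tD/top; rewrite /lnk => /negPf ->.
have Gt v : v \in t -> vert G v by move/tD/layers_vert.
have Ga := layers_vert aD.
rewrite (adj_lnk lG Ga (Gt _ bt)) in ab.
rewrite (adj_lnk lG (Gt _ b't) Ga) lnkC in b'a.
rewrite (path_adj lG) // in pt.
have [q [qp ql qs qD]] := buildable_detour (@cov_rank G) bG aD top
  (toa _ bt ab) (toa _ b't b'a) tD pt at_.
have qG v : v \in b :: q -> vert G v by move/qD=> [/below_l/layers_vert].
exists q; split=> /=; last 2 first.
(* The rest of the cycle between [b] and [b'] has two edges fewer than the cycle, one better than
   required. *)
- by rewrite size_rcons; exact: leqW.
(* An interior vertex has a lower neighbour of type at least [h], so its own type exceeds [h]. *)
- move=> v vq tv; have [_ _ [vt|[x [z [[_ tx] _ /cov_typ xv _]]]]] := qD v vq.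
    by rewrite inE vt orbT.
  by lia.
split=> //; first by rewrite (path_adj lG).
move=> v /= vq; have [va nva _] := qD v vq; split; first exact: qG.
split.
  apply/residueE; right; apply: below_sub va; exact: layers_vert.
have [Gv tv] := below_l va; split=> //.
have : typ G v < i; last by lia.
by rewrite ltnNge -ta; apply/negP => /(below_typ_eq va).
Qed.

(** Flipping [cov] makes [a] maximal and reduces this to the argument of [detour_down]; an interior
    vertex now has type below [h] because of its upper neighbour. *)
Lemma detour_up lo hi G i h a b p b' : layered lo hi G ->
  buildable (cov G) (layers G i h) -> typ G a = i ->
  simple_cycle G (layers G i h) (a :: b :: rcons p b') ->
  detour G h i.+1 h a b b' (a :: b :: rcons p b').
Proof.
move=> lG /buildable_flip bG ta /simple_cycle_split[ab b'a pt at_ sD].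
set t := b :: rcons p b' in at_ sD *.
have tD v : v \in t -> layers G i h v by move=> vt; apply: sD; rewrite inE vt orbT.
have aD : layers G i h a by apply: sD; rewrite inE eqxx.
have top z : layers G i h z -> ~~ flip (cov G) a z.
  by move=> [_ tz]; apply: contraL tz => /cov_typ; rewrite ta => ->; lia.
have bt : b \in t by rewrite inE eqxx.
have b't : b' \in t by rewrite inE mem_rcons inE eqxx orbT.
have toa v : v \in t -> lnk (cov G) a v -> flip (cov G) v a.
  by move=> /tD/top; rewrite -lnk_flip /lnk => /negPf ->.
have Gt v : v \in t -> vert G v by move/tD/layers_vert.
have Ga := layers_vert aD.
rewrite (adj_lnk lG Ga (Gt _ bt)) in ab.
rewrite (adj_lnk lG (Gt _ b't) Ga) lnkC in b'a.
rewrite (path_adj lG) // -(eq_path (lnk_flip _)) in pt.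
have [q [qp ql qs qD]] := buildable_detour (@flip_cov_rank G) bG aD top
  (toa _ bt ab) (toa _ b't b'a) tD pt at_.
have qG v : v \in b :: q -> vert G v by move/qD=> [/below_l/layers_vert].
exists q; split=> /=; last 2 first.
- by rewrite size_rcons; exact: leqW.
- move=> v vq tv; have [_ _ [vt|[x [z [[_ tx] _ /cov_typ xv _]]]]] := qD v vq.
    by rewrite inE vt orbT.
  by lia.
split=> //; first by rewrite (path_adj lG) // -(eq_path (lnk_flip _)).
move=> v /= vq; have [/below_flip va nva _] := qD v vq; split; first exact: qG.
split.
  apply/residueE; left; apply: below_sub va; exact: layers_vert.
have [Gv tv] := below_r va; split=> //.
have : i < typ G v; last by lia.
by rewrite ltnNge -ta; apply/negP => /(below_typ_eq va) E; apply: nva.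
Qed.

(** An interior vertex would have two neighbours in [D] whose types differ by two, while [D] meets
    only two consecutive types. *)
Lemma no_cycle lo hi G (D : set T) i s : layered lo hi G ->
  buildable (cov G) (fun v => vert G v /\ D v) ->
  (forall v, vert G v -> D v -> i <= typ G v <= i.+1) ->
  ~ simple_cycle G D s.
Proof.
move=> lG bG Di [sc us ss sD].
have scl : cycle (lnk (cov G)) s.
  case: s sc sD {us ss} => // x p; rewrite /cycle => xp sD.
  rewrite -(path_adj lG) // => v; rewrite inE mem_rcons inE => /or3P[/eqP->|/eqP->|vp].
  - by case: (sD x) => //; rewrite /= inE eqxx.
  - by case: (sD x) => //; rewrite /= inE eqxx.
  by case: (sD v) => //; rewrite /= inE [_ \in _]vp orbT.
have ni v : ~ interior (cov G) (fun v => vert G v /\ D v) v.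
  move=> [x [z [[Gx Dx] [Gz Dz] /cov_typ xv /cov_typ vz]]].
  by have := Di _ Gx Dx; have := Di _ Gz Dz; lia.
exact: buildable_acyclic bG ni scl us ss sD.
Qed.

(** Ranges of layers are convex, hence buildable, so the meet, detour and cycle lemmas give all
    clauses. This admits one-point extensions to the universal property of the limit. *)
Lemma Kclass_buildable n G : finite_set (vert G) -> Lgraph n G ->
  buildable (cov G) (vert G) -> Kclass n G.
Proof.
move=> fG LG bG; have lG := (layered_Lgraph _ _).2 LG.
have blay i j : buildable (cov G) (layers G i j).
  have := buildable_sub (F := fun v => i <= typ G v <= j) bG; apply.
  by move=> x y z _ _ _ /cov_typ xy /cov_typ yz; lia.
split=> //.
- move=> i s i1; apply: (no_cycle (i := i.-1) lG).
    have -> : (fun v => vert G v /\ layers G i.-1 i v) = layers G i.-1 i.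
      by apply/seteqP; split=> v /=; [case|move=> L; split=> //; case: L].
    exact: blay.
  by move=> v _ [_]; lia.
- by move=> x y _ _ _; apply: meets_bot lG bG.
- by move=> x y _ _ _; apply: meets_top lG bG.
- by move=> i h a b p b' s _ ta _ _; apply: detour_down lG (blay _ _) ta.
- by move=> i h a b p b' s _ ta _ _; apply: detour_up lG (blay _ _) ta.
Qed.

(** * Rich graphs, their layers and residues, and the pseudospace axioms *)

(* Carries the types lo, ..., hi unshifted, so that layers and residues
   have this form without renumbering. *)
Record rich lo hi G : Prop := Rich {
  rich_layered : layered lo hi G;
  rich_buildable : buildable (cov G) (vert G);
  rich_up : forall x, vert G x -> typ G x < hi ->
    infinite_set [set y | vert G y /\ cov G x y];
  rich_down : forall x, vert G x -> lo < typ G x ->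
    infinite_set [set y | vert G y /\ cov G y x];
  rich_between : forall x y z, vert G x -> vert G y -> vert G z ->
    cov G x y -> cov G y z ->
    infinite_set [set v | [/\ vert G v, cov G x v & cov G v z]] }.

Lemma rich_renumber lo hi G : rich lo.+1 hi.+1 G -> rich lo hi (renumber G).
Proof.
case=> lG bG up dn md.
(* The predecessor identifies the types 0 and 1; covers survive because all types are positive. *)
have pos x : vert G x -> lo < typ G x by move/(layered_typ lG)/andP=> [].
have cE u v : vert G u -> vert G v -> cov (renumber G) u v = cov G u v.
  by move=> /pos Gu /pos Gv; rewrite /cov /=; congr (_ && _); lia.
have subE (P Q : T -> Prop) : (forall v, vert G v -> P v -> Q v) ->
    infinite_set [set v | vert G v /\ P v] -> infinite_set [set v | vert G v /\ Q v].
  by move=> PQ; apply: sub_infinite_set => v /= [Gv /(PQ _ Gv)].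
split=> /=.
- split=> /= [x Gx|x y Gx Gy|x y Gx Gy xy].
  + by have := layered_typ lG Gx; lia.
  + exact: layered_sym lG _ _ Gx Gy.
  + by have := layered_adj lG Gx Gy xy; have := pos _ Gx; have := pos _ Gy; lia.
- exact: buildable_eq bG.
- move=> x Gx tx; have /(subE _ (fun y => cov (renumber G) x y)) : infinite_set
      [set y | vert G y /\ cov G x y] by apply: up => //; have := pos _ Gx; lia.
  by apply=> v Gv; rewrite cE.
- move=> x Gx tx; have /(subE _ (fun y => cov (renumber G) y x)) : infinite_set
      [set y | vert G y /\ cov G y x] by apply: dn => //; have := pos _ Gx; lia.
  by apply=> v Gv; rewrite cE.
move=> x y z Gx Gy Gz; rewrite !cE // => xy yz.
apply: sub_infinite_set (md x y z Gx Gy Gz xy yz) => v /= [Gv xv vz].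
by rewrite !cE.
Qed.

(** Convexity puts every vertex between two vertices of [F] into [F], so [rich_between] is
    inherited; only neighbours on one side have to be supplied. *)
Lemma rich_induced lo hi lo' hi' G (F : set T) : rich lo hi G ->
  (forall x y z, vert G x -> vert G y -> vert G z -> cov G x y -> cov G y z ->
     F x -> F z -> F y) ->
  (forall x, vert G x -> F x -> lo' <= typ G x <= hi') ->
  (forall x, vert G x -> F x -> typ G x < hi' ->
    infinite_set [set y | [/\ vert G y, F y & cov G x y]]) ->
  (forall x, vert G x -> F x -> lo' < typ G x ->
    infinite_set [set y | [/\ vert G y, F y & cov G y x]]) ->
  rich lo' hi' (induced G F).
Proof.
case=> lG bG _ _ md cv tF up dn; split=> /=.
- split=> /= [x [Gx]|x y [Gx _] [Gy _]|x y [Gx _] [Gy _]]; first exact: tF.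
  + exact: layered_sym lG _ _ Gx Gy.
  + exact: layered_adj lG _ _ Gx Gy.
- exact: buildable_sub bG cv.
- move=> x [Gx Fx] /(up _ Gx Fx); apply: sub_infinite_set.
  by move=> y [Gy Fy xy].
- move=> x [Gx Fx] /(dn _ Gx Fx); apply: sub_infinite_set.
  by move=> y [Gy Fy xy].
move=> x y z [Gx Fx] [Gy Fy] [Gz Fz] xy yz.
apply: sub_infinite_set (md x y z Gx Gy Gz xy yz) => v /= [Gv xv vz].
by split=> //; split=> //; apply: (cv x v z).
Qed.

Lemma rich_layers_bot lo hi G :
  rich lo hi.+1 G -> rich lo hi (induced G (layers G lo hi)).
Proof.
move=> rG; apply: (rich_induced rG).
- by move=> x y z _ Gy _ /cov_typ xy /cov_typ yz [_ tx] [_ tz]; split=> //; lia.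
- by move=> x _ [].
- move=> x Gx [_ tx] tx'; have : typ G x < hi.+1 by lia.
  move/(rich_up rG Gx); apply: sub_infinite_set => y /= [Gy xy].
  by split=> //; split=> //; rewrite (cov_typ xy); lia.
move=> x Gx [_ tx] tx'.
apply: sub_infinite_set (rich_down rG Gx tx') => y /= [Gy yx].
by split=> //; split=> //; move: (cov_typ yx); lia.
Qed.

Lemma rich_layers_top lo hi G :
  rich lo hi G -> rich lo.+1 hi (induced G (layers G lo.+1 hi)).
Proof.
move=> rG; apply: (rich_induced rG).
- by move=> x y z _ Gy _ /cov_typ xy /cov_typ yz [_ tx] [_ tz]; split=> //; lia.
- by move=> x _ [].
- move=> x Gx [_ tx] tx'.
  apply: sub_infinite_set (rich_up rG Gx tx') => y /= [Gy xy].
  by split=> //; split=> //; rewrite (cov_typ xy); lia.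
move=> x Gx [_ tx] tx'; have : lo < typ G x by lia.
move/(rich_down rG Gx); apply: sub_infinite_set => y /= [Gy yx].
by split=> //; split=> //; move: (cov_typ yx); lia.
Qed.

Lemma below_last G D x y : below (cov G) D x y ->
  x = y \/ exists2 z, below (cov G) D x z & cov G z y.
Proof.
elim=> {x y} [x _|x y z Dx xy _ [<-|[u yu uz]]]; first by left.
  by right; exists x => //; apply: below_refl.
by right; exists u => //; apply: below_cons yu.
Qed.

Lemma below_first G D x y : below (cov G) D x y ->
  x = y \/ exists2 z, below (cov G) D z y & cov G x z.
Proof. by case=> [|u v w _ uv vw]; [left|right; exists v]. Qed.

(** The vertices above [x0] are closed upwards, so upper neighbours cause no loss. For lower
    neighbours of [x], take the last steps [e], [d], [x] of a chain from [x0]: the infinitely many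
    vertices between [e] and [x] all lie above [x0]. *)
Lemma rich_residue_bot lo hi G x0 : rich lo hi G -> vert G x0 -> typ G x0 = lo ->
  rich lo.+1 hi (induced G (residue G x0 `&` layers G lo.+1 hi)).
Proof.
move=> rG Gx0 t0.
have FE x : (residue G x0 `&` layers G lo.+1 hi)%classic x <->
    below (cov G) (vert G) x0 x /\ lo < typ G x.
  split=> [[/residueE[x0x|xx0] [Gx tx]]|[x0x tx]]; first by split=> //; lia.
    by move/below_typ: xx0; lia.
  split; first by apply/residueE; left.
  have Gx := below_r x0x; split=> //.
  by have := layered_typ (rich_layered rG) Gx; lia.
apply: (rich_induced rG).
- move=> x y z Gx Gy Gz xy yz /FE[x0x tx] _; apply/FE; split.
    by apply: (below_trans x0x); apply: below_cov xy.
  by rewrite (cov_typ xy); lia.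
- by move=> x _ [_ []].
- move=> x Gx /FE[x0x tx] tx'.
  apply: sub_infinite_set (rich_up rG Gx tx') => y /= [Gy xy].
  split=> //; apply/FE; split; last by rewrite (cov_typ xy); lia.
  by apply: (below_trans x0x); apply: below_cov xy.
move=> x Gx /FE[x0x tx] tx'.
case: (below_last x0x) => [E|[d x0d dx]]; first by rewrite -E t0 ltnn in tx.
case: (below_last x0d) => [E|[e x0e ed]].
  by move: (cov_typ dx); rewrite -E t0; lia.
apply: sub_infinite_set (rich_between rG (below_r x0e) (below_r x0d) Gx ed dx).
move=> y /= [Gy ey yx]; split=> //; apply/FE; split; last by move: (cov_typ yx); lia.
by apply: (below_trans x0e); apply: below_cov ey => //; exact: below_r x0e.
Qed.

(** Dual argument, using the first steps [x], [d], [e] of a chain up to [x0]. *)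
Lemma rich_residue_top lo hi G x0 : rich lo hi.+1 G -> vert G x0 ->
  typ G x0 = hi.+1 -> rich lo hi (induced G (residue G x0 `&` layers G lo hi)).
Proof.
move=> rG Gx0 t0.
have FE x : (residue G x0 `&` layers G lo hi)%classic x <->
    below (cov G) (vert G) x x0 /\ typ G x <= hi.
  split=> [[/residueE[x0x|xx0] [Gx tx]]|[x0x tx]].
  - by move/below_typ: x0x; lia.
  - by split=> //; lia.
  split; first by apply/residueE; right.
  have Gx := below_l x0x; split=> //.
  by have := layered_typ (rich_layered rG) Gx; lia.
apply: (rich_induced rG).
- move=> x y z Gx Gy Gz xy yz _ /FE[zx0 tz]; apply/FE; split.
    by apply: (below_trans _ zx0); apply: below_cov yz.
  by move: (cov_typ yz); lia.
- by move=> x _ [_ []].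
- move=> x Gx /FE[xx0 tx] tx'.
  case: (below_first xx0) => [E|[d dx0 xd]]; first by rewrite E t0 ltnn in tx.
  case: (below_first dx0) => [E|[e ex0 de]].
    by move: (cov_typ xd); rewrite E t0; lia.
  apply: sub_infinite_set (rich_between rG Gx (below_l dx0) (below_l ex0) xd de).
  move=> y /= [Gy xy ye]; split=> //; apply/FE; split; last by move: (cov_typ xy); lia.
  by apply: (below_trans _ ex0); apply: below_cov ye => //; exact: below_l ex0.
move=> x Gx /FE[xx0 tx] tx'.
apply: sub_infinite_set (rich_down rG Gx tx') => y /= [Gy yx].
split=> //; apply/FE; split; last by move: (cov_typ yx); lia.
by apply: (below_trans _ xx0); apply: below_cov yx.
Qed.

(** Layers and residues are rich again, after renumbering when they start at type 1, so induction on
    the dimension gives the first two axioms; the others hold in every buildable layered graph. *)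
Lemma rich_free_pseudospace m G : rich 0 m.+1 G -> free_pseudospace m.+1 G.
Proof.
elim: m G => [|m IH] G rG; have lG := rich_layered rG; have bG := rich_buildable rG;
  have LG := (layered_Lgraph _ _).1 lG.
  split=> // [s|x Gx].
    apply: (no_cycle (i := 0) lG); last by move=> v /(layered_typ lG).
    have -> : (fun v => vert G v /\ setT v) = vert G by
      apply/seteqP; split=> v /=; [case|].
    exact: bG.
  case/andP: (layered_typ lG Gx) => _; rewrite leq_eqVlt => /orP[/eqP tx|tx].
    have /(rich_down rG Gx) : 0 < typ G x by rewrite tx.
    apply: sub_infinite_set => y /= [Gy /andP[yx _]]; split=> //.
    exact: layered_sym lG _ _ Gy Gx yx.
  by apply: sub_infinite_set (rich_up rG Gx tx) => y /= [Gy /andP[xy _]].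
have lE : layers G 0 m.+2 = vert G.
  apply/seteqP; split=> v /=; first exact: layers_vert.
  by move=> Gv; split=> //; apply: layered_typ lG _ Gv.
have cycE s : simple_cycle G setT s -> simple_cycle G (layers G 0 m.+2) s.
  by case=> c u l sD; split=> // v /sD[Gv _]; split=> //; rewrite lE.
split=> //.
- by split; apply: IH; [apply: rich_layers_bot|apply: rich_renumber; apply: rich_layers_top].
- split=> x Gx tx; apply: IH; last exact: rich_residue_top.
  by apply: rich_renumber; apply: rich_residue_bot.
- by split=> x y Gx Gy; [apply: meets_bot lG bG|apply: meets_top lG bG].
have bl : buildable (cov G) (layers G 0 m.+2) by rewrite lE.
split=> a b p b' s ta /cycE sc; first exact: detour_down lG bl ta sc.
exact: detour_up lG bl ta sc.
Qed.

End TypedGraph.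

(** * From strong extensions to constructions *)

Local Open Scope classical_set_scope.

Definition built (T : choiceType) (G : tgraph T) (A : set T) : Prop :=
  exists2 X, constructible (cov G) X & A = [set` X].

Lemma built_buildable (T : choiceType) (G : tgraph T) (A : set T) :
  built G A -> buildable (cov G) A.
Proof. by case=> X cX -> s sX; exists X; split. Qed.

Lemma strong_vert (T : choiceType) (G : tgraph T) (A B : set T) :
  A `<=` vert G -> strong G A B -> B `<=` vert G.
Proof.
move=> AG; elim=> {B} // B w _ BG [Gw _ _] v [/BG//|].
by rewrite /= => ->.
Qed.

Lemma strong_sub (T : choiceType) (G : tgraph T) (A B : set T) :
  strong G A B -> A `<=` B.
Proof. by elim=> {B} // B w _ AB _ v /AB; left. Qed.

(** A leaf has at most one older neighbour, and that one cannot be both above and below it. A vertex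
    added along a flag [x], [y], [z] has, by types, only [z] above and only [x] below, and [y] is
    the required vertex between them. *)
Lemma strong_built (T : choiceType) (G : tgraph T) (A B : set T) :
  (forall x y, vert G x -> vert G y -> adj G x y -> adj G y x) ->
  A `<=` vert G -> strong G A B -> built G A -> built G B.
Proof.
move=> sG AG sAB bA; elim: sAB => {B} // B w sAB [X cX BX] [Gw Bw wP].
have BG := strong_vert AG sAB.
have XB v : v \in X -> B v by rewrite BX.
have adjE v : v \in X -> cov G v w -> adj G w v.
  by move=> /XB/BG Gv /andP[vw _]; apply: sG.
have adjE' v : cov G w v -> adj G w v by case/andP.
exists (w :: X); last first.
  rewrite BX; apply/seteqP; split=> v /=; rewrite inE.
    by case=> [->|->]; rewrite ?eqxx ?orbT.
  by case/predU1P; [right|left].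
have wX : w \notin X by apply/negP => /XB.
case: wP => [leaf|[x [y [z [xyzB [/= /and3P[xy yz _] _] wy wP]]]]].
  split=> // u v uX vX.
  - by move=> /adjE' wu /adjE' wv; apply: leaf => //; exact: XB.
  - by move=> /(adjE _ uX) wu /(adjE _ vX) wv; apply: leaf => //; exact: XB.
  move=> uw wv; have uv : u = v.
    by apply: leaf; [exact: XB..|exact: adjE|exact: adjE'].
  by move: (cov_typ uw) (cov_typ wv); rewrite uv; lia.
have xX : x \in X by have := xyzB x; rewrite BX; apply; rewrite /= inE eqxx.
have yX : y \in X by have := xyzB y; rewrite BX; apply; rewrite /= !inE eqxx orbT.
have txy := cov_typ xy; have tyz := cov_typ yz.
have upE u : u \in X -> cov G w u -> u = z.
  move=> uX wu; have [+ _] := wP u (XB u uX); case/(_ (adjE' _ wu)) => // ux.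
  by move: (cov_typ wu); rewrite ux; lia.
have dnE u : u \in X -> cov G u w -> u = x.
  move=> uX uw; have [+ _] := wP u (XB u uX); case/(_ (adjE _ uX uw)) => // uz.
  by move: (cov_typ uw); rewrite uz; lia.
split=> // u v uX vX.
- by move=> /(upE _ uX)-> /(upE _ vX)->.
- by move=> /(dnE _ uX)-> /(dnE _ vX)->.
move=> /(dnE _ uX)-> /(upE _ vX)->; exists y => //; exact/andP.
Qed.

(** * The limit is rich: buildability and realisation of one-point extensions *)

Section Limit.
Variables (n : nat) (T : choiceType) (M : tgraph T) (A : nat -> set T).
Hypotheses (MA : vert M = \bigcup_i A i) (A0 : A 0 = set0).
Hypothesis KA : forall i, Kclass n (induced M (A i)).
Hypothesis sA : forall i, strong M (A i) (A i.+1).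
Hypothesis extA : forall i (D : set T) (U : choiceType) (C : tgraph U) (f : T -> U),
  strong M D (A i) -> Kclass n C -> embedding (induced M D) C f ->
  strong C (f @` D) (vert C) ->
  exists j (g : U -> T),
    [/\ i <= j, embedding C (induced M (A j)) g,
        forall x, D x -> g (f x) = x
      & strong M (g @` vert C) (A j)].

Lemma chain_mono i j : i <= j -> A i `<=` A j.
Proof.
elim: j => [|j IH]; first by rewrite leqn0 => /eqP->.
rewrite leq_eqVlt => /orP[/eqP->//|/IH ij v /ij]; exact: strong_sub.
Qed.

Lemma chain_vert i v : A i v -> vert M v.
Proof. by rewrite MA => Av; exists i. Qed.

Lemma chain_capture (s : seq T) :
  (forall v, v \in s -> vert M v) -> exists k, forall v, v \in s -> A k v.
Proof.
elim: s => [|x s IH] sM; first by exists 0.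
have [|k kP] := IH; first by move=> v vs; apply: sM; rewrite inE vs orbT.
have : vert M x by apply: sM; rewrite inE eqxx.
rewrite MA => -[i _ Ax]; exists (maxn i k) => v.
rewrite inE => /predU1P[->|/kP]; first exact: chain_mono (leq_maxl i k) _ Ax.
exact: chain_mono (leq_maxr i k) v.
Qed.

Lemma limit_layered : layered 0 n M.
Proof.
have two x y : vert M x -> vert M y -> exists k, A k x /\ A k y.
  move=> Mx My; have [|k kP] := chain_capture (s := [:: x; y]).
    by move=> v; rewrite !inE => /orP[] /eqP->.
  by exists k; split; apply: kP; rewrite !inE eqxx ?orbT.
split=> [x Mx|x y Mx My|x y Mx My].
- by have [k [Ax _]] := two x x Mx Mx; case: (K_Lgraph (KA k)) => + _ _; apply.
- by have [k [Ax Ay]] := two x y Mx My; case: (K_Lgraph (KA k)) => _ + _; apply.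
by have [k [Ax Ay]] := two x y Mx My; case: (K_Lgraph (KA k)) => _ _; apply.
Qed.

Lemma chain_built i : built M (A i).
Proof.
elim: i => [|i IH]; first by exists [::]; rewrite // A0; apply/seteqP; split.
apply: strong_built (sA i) IH; last by move=> v; exact: chain_vert.
exact: layered_sym limit_layered.
Qed.

Lemma limit_buildable : buildable (cov M) (vert M).
Proof.
move=> s /chain_capture[k kP]; have [X cX AX] := chain_built k.
exists X; split=> // v vX; last by apply: (@chain_vert k); rewrite AX.
by have := kP _ vX; rewrite AX.
Qed.

(** The universal property takes abstract extensions, so the new vertex is [None] in [option T],
    with [P] as its set of neighbours. *)
Definition one_point_adj (P : pred T) : rel (option T) := fun a b =>
  match a, b with
  | Some u, Some v => adj M u v
  | Some u, None => P u
  | None, Some u => P u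
  | None, None => false
  end.

Definition one_point k t (P : pred T) : tgraph (option T) :=
  TGraph (some @` A k `|` [set None]) (oapp (typ M) t) (one_point_adj P).

Lemma one_point_Lgraph k t (P : pred T) : t <= n ->
  (forall u, A k u -> P u -> typ M u = t.+1 \/ t = (typ M u).+1) ->
  Lgraph n (one_point k t P).
Proof.
have [typM symM adjM] := limit_layered => tn tP.
split=> /= [x [[u Au <-]|->]//=|x y|x y]; first exact: (typM u (chain_vert Au)).
- by case=> [[u Au <-]|->] [[v Av <-]|->] //=; exact: symM (chain_vert Au) (chain_vert Av).
case=> [[u /[dup] Au /chain_vert Mu <-]|->] [[v /[dup] Av /chain_vert Mv <-]|->] //=.
- exact: adjM.
- by case/(tP _ Au); [right|left].
by case/(tP _ Av); [left|right].
Qed.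

Lemma one_point_strong k t (P : pred T) :
  (forall u v, A k u -> A k v -> P u -> P v -> u = v) \/
    (exists x y z, [/\ [set` [:: x; y; z]] `<=` A k, dense_flag M x [:: y; z],
       t = typ M y & forall u, A k u -> (P u <-> u = x \/ u = z)]) ->
  strong (one_point k t P) (some @` A k) (vert (one_point k t P)).
Proof.
move=> h; apply: strong_step (strong_refl _ _) _; split; first by right.
  by case.
case: h => [h|[x [y [z [xyz [/= fl _] ty h]]]]]; [left|right].
  by move=> _ _ [u Au <-] [v Av <-] /= Pu Pv; rewrite (h u v).
exists (Some x), (Some y), (Some z); split=> //=.
- move=> v; rewrite /= !inE => /or3P[] /eqP->; apply: imageP; apply: xyz;
    by rewrite /= !inE eqxx ?orbT.
- split=> //=; move=> v; rewrite /= !inE => /or3P[] /eqP->; left; apply: imageP; apply: xyz;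
    by rewrite /= !inE eqxx ?orbT.
move=> _ [u Au <-] /=; split=> [/(h u Au)[->|->]|ux]; [by left|by right|].
by apply/(h u Au); case: ux => -[->]; [left|right].
Qed.

(** [A k] is constructed from the empty set, hence so is its strong extension, and constructed
    finite graphs belong to the class. *)
Lemma one_point_Kclass k t (P : pred T) : Lgraph n (one_point k t P) ->
  strong (one_point k t P) (some @` A k) (vert (one_point k t P)) ->
  Kclass n (one_point k t P).
Proof.
move=> LC sC; apply: Kclass_buildable => //.
  rewrite finite_setU; split; last exact: finite_set1.
  apply: finite_image; have := K_finite (KA k) => /=.
  by rewrite setIidr // => v; exact: chain_vert.
apply: built_buildable; apply: strong_built sC _; first by case: LC.
  by move=> v; left.
have [X cX AX] := chain_built k; exists (map some X).
  by apply: constructible_map cX => // u v _ _ [].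
rewrite AX; apply/seteqP; split=> v /=; first by case=> u uX <-; exact: map_f.
by case/mapP=> u uX ->; exists u.
Qed.

(** The universal property with [D] equal to [A k] itself embeds the abstract extension over [A k];
    the image of [None] is the wanted vertex. *)
Lemma limit_extend k t (P : pred T) : t <= n ->
  (forall u, A k u -> P u -> typ M u = t.+1 \/ t = (typ M u).+1) ->
  (forall u v, A k u -> A k v -> P u -> P v -> u = v) \/
    (exists x y z, [/\ [set` [:: x; y; z]] `<=` A k, dense_flag M x [:: y; z],
       t = typ M y & forall u, A k u -> (P u <-> u = x \/ u = z)]) ->
  exists w, [/\ vert M w, ~ A k w, typ M w = t
    & forall u, A k u -> adj M w u = P u /\ adj M u w = P u].
Proof.
move=> tn tP /(one_point_strong (t := t)) sC.
have KC := one_point_Kclass (one_point_Lgraph tn tP) sC.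
have emb : embedding (induced M (A k)) (one_point k t P) some.
  by split=> //= _ [u [_ Au] <-]; left; exists u.
have [j [g [kj [gA gI gt ga] gf _]]] := extA (strong_refl _ _) KC emb sC.
have None_vert : vert (one_point k t P) None by right.
have [Mg Ag] : (vert M `&` A j) (g None) by apply: gA; exists None => //; right.
have some_vert u : A k u -> vert (one_point k t P) (Some u).
  by move=> Au; left; exists u.
exists (g None); split=> //.
(* If [g None] were in [A k], then [g] would send [Some (g None)] to the same point as [None],
   against injectivity. *)
- move=> Akg; have E := gf _ Akg.
  have := gI (Some (g None)) None; rewrite !inE => /(_ (some_vert _ Akg) None_vert E).
  by [].
- exact: gt None_vert.
move=> u Au; have := ga _ _ None_vert (some_vert u Au).
have := ga _ _ (some_vert u Au) None_vert.
by rewrite /= (gf u Au) => -> ->.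
Qed.

(** A finite [E] would be contained, together with the parameters [s], in some [A k], outside which
    a further element of [E] exists. *)
Lemma limit_infinite (E : set T) (s : seq T) :
  E `<=` vert M -> (forall v, v \in s -> vert M v) ->
  (forall k, (forall v, v \in s -> A k v) -> exists2 w, E w & ~ A k w) ->
  infinite_set E.
Proof.
move=> EM sM ext /finite_seqP[e Ee].
have [|k kP] := chain_capture (s := s ++ e).
  by move=> v; rewrite mem_cat => /orP[/sM//|ve]; apply: EM; rewrite Ee.
have [|w Ew []] := ext k; first by move=> v vs; apply: kP; rewrite mem_cat vs.
by apply: kP; move: Ew; rewrite Ee /= mem_cat => ->; rewrite orbT.
Qed.

(** Neighbours of [x] come from leaves attached to [x] alone, vertices between [x] and [z] from
    extensions along the flag [x], [y], [z]. *)
Lemma limit_rich : rich 0 n M.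
Proof.
have lM := limit_layered; split=> //; first exact: limit_buildable.
- move=> x Mx tx; apply: (limit_infinite (s := [:: x])) => [y []//|v|k kx].
    by rewrite inE => /eqP->.
  have Ax : A k x by apply: kx; rewrite inE.
  have [||w [Mw Aw tw aw]] := @limit_extend k (typ M x).+1 (pred1 x) tx.
  + by move=> u _ /eqP->; right.
  + by left=> u v _ _ /eqP-> /eqP->.
  exists w => //; split=> //; rewrite /cov tw eqxx andbT.
  by rewrite (aw x Ax).2 /= eqxx.
- move=> x Mx tx; apply: (limit_infinite (s := [:: x])) => [y []//|v|k kx].
    by rewrite inE => /eqP->.
  have Ax : A k x by apply: kx; rewrite inE.
  have [|||w [Mw Aw tw aw]] := @limit_extend k (typ M x).-1 (pred1 x).
  + by have := layered_typ lM Mx; lia.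
  + by move=> u _ /eqP->; left; lia.
  + by left=> u v _ _ /eqP-> /eqP->.
  exists w => //; split=> //; rewrite /cov tw (aw x Ax).1 /= eqxx.
  by apply/eqP; lia.
move=> x y z Mx My Mz xy yz.
apply: (limit_infinite (s := [:: x; y; z])) => [v []//|v|k kxyz].
  by rewrite !inE => /or3P[] /eqP->.
have txy := cov_typ xy; have tyz := cov_typ yz.
have [|||w [Mw Aw tw aw]] := @limit_extend k (typ M y) (pred2 x z).
- by have := layered_typ lM My; lia.
- by move=> u _ /orP[] /eqP->; [right|left].
- right; exists x, y, z; split=> //.
    split; first by rewrite /= -!/(cov M _ _) xy yz.
    by move=> v; rewrite /= !inE => /or3P[] /eqP->.
  move=> u _ /=; split; first by case/orP=> /eqP->; [left|right].
  by case=> ->; rewrite eqxx ?orbT.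
have Ax : A k x by apply: kxyz; rewrite !inE eqxx.
have Az : A k z by apply: kxyz; rewrite !inE eqxx !orbT.
exists w => //; split=> //; rewrite /cov tw.
  by rewrite (aw x Ax).2 /= eqxx /= txy.
by rewrite (aw z Az).1 /= eqxx orbT /= tyz.
Qed.

End Limit.

Theorem proposition2p6 (n : nat) (T : choiceType) (M : tgraph T) :
  1 <= n -> hrushovski_limit n M -> free_pseudospace n M.
Proof.
(* Dimension 0, where [free_pseudospace] has its placeholder value, is excluded. *)
case: n => // m _ [A [MA A0 KA sA extA]].
exact: rich_free_pseudospace (limit_rich MA A0 KA sA extA).
Qed.
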